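(* Let $U=U(S_{\rm std},\mathcal{P}_{\rm std},F_4)$ be the two-dimensional Fourier walk acting on $\ell^2(\mathbb{Z}^2,\mathbb{C}^4)$. Then $U$ has no eigenvalues, i.e. its point spectrum is empty. Consequently, for every unit vector $\phi\in\mathbb{C}^4$ and every $x\in\mathbb{Z}^2$, $\lim_{n\to\infty}p_n(\phi;x)=0$.
   Context: Let $u_1,u_2$ be the standard basis of $\mathbb{Z}^2$ and $\mathbf{e}_1,\dots,\mathbf{e}_4$ the standard basis of $\mathbb{C}^4$; let $P_j$ denote the orthogonal projection onto $\mathbb{C}\mathbf{e}_j$. Set $S_{\rm std}=\{\pm u_1,\pm u_2\}$ and $\mathcal{P}_{\rm std}=\{P_\alpha\}_{\alpha\in S_{\rm std}}$ with $P_{u_j}=P_{2j-1}$, $P_{-u_j}=P_{2j}$. For $\alpha\in\mathbb{Z}^2$, $\tau^\alpha$ acts on $\ell^2(\mathbb{Z}^2,\mathbb{C}^4)$ by $(\tau^\alpha f)(x)=f(x-\alpha)$. For a $4\times 4$ unitary matrix $C$ (acting pointwise), $U(S_{\rm std},\mathcal{P}_{\rm std},C)=\big(\sum_{\alpha\in S_{\rm std}}\tau^\alpha P_\alpha\big)C$. $F_4$ is the discrete Fourier matrix $F_4=\frac12\big(q^{(j-1)(k-1)}\big)_{j,k=1}^4$ with $q=e^{2\pi i/4}=i$. For a unit vector $\phi\in\mathbb{C}^4$, $\delta_0\otimes\phi$ is the function equal to $\phi$ at $0$ and $0$ elsewhere, and $p_n(\phi;x)=\|U^n(\delta_0\otimes\phi)(x)\|_{\mathbb{C}^4}^2$.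 *)

(* Defs.v *)
From Stdlib Require Import Reals ZArith Lra.
Open Scope R_scope.

Record Cpx := mkC { re : R; im : R }.
Definition C0 : Cpx := mkC 0 0.
Definition Cadd (a b : Cpx) : Cpx := mkC (re a + re b) (im a + im b).
Definition Cmul (a b : Cpx) : Cpx :=
  mkC (re a * re b - im a * im b) (re a * im b + im a * re b).
Definition Cnorm2 (a : Cpx) : R := re a * re a + im a * im a.

(* Vectors of C^4 are functions nat -> Cpx, of which only the components
   0,1,2,3 (i.e. e_1,...,e_4) are meaningful. *)
Definition vec := nat -> Cpx.
Definition sum4 (g : nat -> Cpx) : Cpx := Cadd (Cadd (g 0%nat) (g 1%nat)) (Cadd (g 2%nat) (g 3%nat)).
Definition rsum4 (g : nat -> R) : R := g 0%nat + g 1%nat + g 2%nat + g 3%nat.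
Definition vnorm2 (v : vec) : R := rsum4 (fun j => Cnorm2 (v j)).

Definition state := Z -> Z -> vec.

Definition ipow (m : nat) : Cpx :=
  match (m mod 4)%nat with
  | 0%nat => mkC 1 0
  | 1%nat => mkC 0 1
  | 2%nat => mkC (-1) 0
  | _ => mkC 0 (-1)
  end.
Definition F4 (j k : nat) : Cpx := Cmul (mkC (1/2) 0) (ipow (j * k)).

(* Shift direction alpha attached to component k via P_{u_1}=P_1, P_{-u_1}=P_2,
   P_{u_2}=P_3, P_{-u_2}=P_4 (components indexed from 0). *)
Definition shift1 (k : nat) : Z :=
  match k with 0%nat => 1%Z | 1%nat => (-1)%Z | _ => 0%Z end.
Definition shift2 (k : nat) : Z :=
  match k with 2%nat => 1%Z | 3%nat => (-1)%Z | _ => 0%Z end.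

(* U(S_std, P_std, C) = (sum_alpha tau^alpha P_alpha) C, acting on f:
   (U f)(x)_k = (C f(x - alpha_k))_k. *)
Definition Uwalk (Cm : nat -> nat -> Cpx) (f : state) : state :=
  fun x1 x2 k =>
    sum4 (fun l => Cmul (Cm k l) (f (x1 - shift1 k)%Z (x2 - shift2 k)%Z l)).

Definition box_sum (N : nat) (g : Z -> Z -> R) : R :=
  sum_f_R0 (fun i => sum_f_R0 (fun j =>
     g (Z.of_nat i - Z.of_nat N)%Z (Z.of_nat j - Z.of_nat N)%Z) (2 * N)) (2 * N).
Definition in_l2 (f : state) : Prop :=
  exists M : R, forall N : nat, box_sum N (fun x1 x2 => vnorm2 (f x1 x2)) <= M.

Definition is_eigenvalue (Cm : nat -> nat -> Cpx) (lam : Cpx) : Prop :=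
  exists f : state, in_l2 f /\
    (exists x1 x2 j, (j < 4)%nat /\ f x1 x2 j <> C0) /\
    (forall x1 x2 k, (k < 4)%nat -> Uwalk Cm f x1 x2 k = Cmul lam (f x1 x2 k)).

Definition delta0 (phi : vec) : state :=
  fun x1 x2 j => if (Z.eqb x1 0 && Z.eqb x2 0)%bool then phi j else C0.

Definition p_n (Cm : nat -> nat -> Cpx) (n : nat) (phi : vec) (x1 x2 : Z) : R :=
  vnorm2 (Nat.iter n (Uwalk Cm) (delta0 phi) x1 x2).

(* Main.v *)
(** Let z, w be the unit translations of the lattice. By Cayley-Hamilton U satisfies
    U^4 - e1 U^3 + e2 U^2 + e1 U - i = 0, where e1 = (z + i/z + w + i/w)/2 and
    e2 = (i-1)/4 (2 + z/w + w/z). Let Y be multiplication by x1 + x2: it commutes with e2,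
    and [Y, e1] = de1 = (z - i/z + w - i/w)/2. For psi of finite support, differentiating the
    spectral asymptotics of a_n = U^n psi in the direction of Y shows that
    (n+3) de1 a_{n+3} - (n+1) de1 a_{n+1} stays bounded at each point, hence
    de1 (U^2 - 1) a_n tends to 0 pointwise. As 1 - i + e2 is a multiple of U^2 - 1 by
    Cayley-Hamilton, (1 - i + e2) de1 a_n tends to 0 as well, and this symbol is a product of
    binomials 1 - c z^a w^b with |c| = 1. Such a binomial can be cancelled: a uniformly
    l2-bounded sequence that is asymptotically invariant, up to a phase, under a nontrivial
    translation has nearly equal moduli at arbitrarily many points, so it tends to 0.
    Approximating an arbitrary l2 state by finitely supported ones, U^n f tends to 0 pointwise,
    which is impossible for an eigenvector since its eigenvalue has modulus at least 1. *)

Require Import Defs.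
From Stdlib Require Import Reals ZArith.
From Stdlib Require Import Lra Lia List FunctionalExtensionality Classical_Prop.
Import ListNotations.
Open Scope R_scope.

(** * Complex numbers as a commutative ring *)

Definition Cone : Cpx := mkC 1 0.
Definition Ci : Cpx := mkC 0 1.
Definition Copp (a : Cpx) : Cpx := mkC (- re a) (- im a).
Definition Csub (a b : Cpx) : Cpx := Cadd a (Copp b).
Definition RtoC (r : R) : Cpx := mkC r 0.

Lemma Cpx_eq (a b : Cpx) : re a = re b -> im a = im b -> a = b.
Proof. destruct a, b; simpl; intros; subst; reflexivity. Qed.

Lemma Cpx_ring_theory : ring_theory C0 Cone Cadd Cmul Csub Copp eq.
Proof. split; intros; apply Cpx_eq; simpl; ring. Qed.
Add Ring Cpx_ring : Cpx_ring_theory.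

Lemma Csub_eq0 (a b : Cpx) : Csub a b = C0 -> a = b.
Proof.
  intro H. replace a with (Cadd (Csub a b) b) by ring. rewrite H. ring.
Qed.

Lemma Cnorm2_ge0 a : 0 <= Cnorm2 a.
Proof. unfold Cnorm2; nra. Qed.

Lemma Cnorm2_add a b : Cnorm2 (Cadd a b) <= 2 * Cnorm2 a + 2 * Cnorm2 b.
Proof.
  unfold Cnorm2; simpl.
  pose proof (Rle_0_sqr (re a - re b)); pose proof (Rle_0_sqr (im a - im b)).
  unfold Rsqr in *; nra.
Qed.

Lemma Cnorm2_mul a b : Cnorm2 (Cmul a b) = Cnorm2 a * Cnorm2 b.
Proof. unfold Cnorm2; simpl; ring. Qed.

Lemma Cnorm2_eq0 a : Cnorm2 a <= 0 -> a = C0.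
Proof.
  unfold Cnorm2; intro H. apply Cpx_eq; simpl; nra.
Qed.

(** * The walk, the coefficient operators and their commutation with translations *)

Definition sadd (f g : state) : state := fun x1 x2 k => Cadd (f x1 x2 k) (g x1 x2 k).
Definition smul (c : Cpx) (f : state) : state := fun x1 x2 k => Cmul c (f x1 x2 k).
Definition translate (y1 y2 : Z) (f : state) : state := fun x1 x2 k => f (y1 + x1)%Z (y2 + x2)%Z k.
(** Components of index 4 and above are junk, but [U] and [Uinv] fill them with values; identities
    such as [Uinv (U f) = f] can only hold on the first four. *)
Definition state_eq (f g : state) : Prop :=
  forall x1 x2 k, (k < 4)%nat -> f x1 x2 k = g x1 x2 k.

Notation U := (Uwalk F4).

(** The adjoint of [U]: undo the shift of each component, then apply the conjugate transpose of
    [F4]. *)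
Definition Uinv (f : state) : state := fun x1 x2 k =>
  sum4 (fun l => Cmul (mkC (re (F4 l k)) (- im (F4 l k)))
                   (f (x1 + shift1 l)%Z (x2 + shift2 l)%Z l)).

(* coef1, coef2 and dcoef1 are the operators e1, e2 and de1 = [Y, e1]. *)
Definition coef1 (f : state) : state := fun x1 x2 k =>
  Cmul (RtoC (1/2)) (Cadd (Cadd (f (x1 - 1)%Z x2 k) (Cmul Ci (f (x1 + 1)%Z x2 k)))
                          (Cadd (f x1 (x2 - 1)%Z k) (Cmul Ci (f x1 (x2 + 1)%Z k)))).
Definition coef2 (f : state) : state := fun x1 x2 k =>
  Cmul (mkC (-1/4) (1/4)) (Cadd (Cadd (f x1 x2 k) (f x1 x2 k))
     (Cadd (f (x1 - 1)%Z (x2 + 1)%Z k) (f (x1 + 1)%Z (x2 - 1)%Z k))).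
Definition dcoef1 (f : state) : state := fun x1 x2 k =>
  Cmul (RtoC (1/2)) (Cadd (Csub (f (x1 - 1)%Z x2 k) (Cmul Ci (f (x1 + 1)%Z x2 k)))
                          (Csub (f x1 (x2 - 1)%Z k) (Cmul Ci (f x1 (x2 + 1)%Z k)))).
Definition Y (f : state) : state := fun x1 x2 k => Cmul (RtoC (IZR (x1 + x2))) (f x1 x2 k).

Lemma state_ext (f g : state) : (forall x1 x2 k, f x1 x2 k = g x1 x2 k) -> f = g.
Proof.
  intro H. do 3 (apply functional_extensionality; intro). apply H.
Qed.

Ltac state_tac :=
  intros; apply state_ext; intros;
  unfold Uwalk, sum4, coef1, coef2, sadd, smul; ring.

Lemma U_add f g : U (sadd f g) = sadd (U f) (U g).
Proof. state_tac. Qed.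
Lemma U_mul c f : U (smul c f) = smul c (U f).
Proof. state_tac. Qed.
Lemma coef1_add f g : coef1 (sadd f g) = sadd (coef1 f) (coef1 g).
Proof. state_tac. Qed.
Lemma coef1_mul c f : coef1 (smul c f) = smul c (coef1 f).
Proof. state_tac. Qed.
Lemma coef2_add f g : coef2 (sadd f g) = sadd (coef2 f) (coef2 g).
Proof. state_tac. Qed.
Lemma coef2_mul c f : coef2 (smul c f) = smul c (coef2 f).
Proof. state_tac. Qed.

Lemma shift_args (f : state) a b a' b' k : a = a' -> b = b' -> f a b k = f a' b' k.
Proof. intros -> ->; reflexivity. Qed.

Lemma U_translate y1 y2 f : U (translate y1 y2 f) = translate y1 y2 (U f).
Proof.
  apply state_ext; intros. unfold Uwalk, translate.
  f_equal; apply functional_extensionality; intro l; f_equal; apply shift_args; lia.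
Qed.
Lemma Uinv_translate y1 y2 f : Uinv (translate y1 y2 f) = translate y1 y2 (Uinv f).
Proof.
  apply state_ext; intros. unfold Uinv, translate.
  f_equal; apply functional_extensionality; intro l; f_equal; apply shift_args; lia.
Qed.
Lemma coef1_translate y1 y2 f : coef1 (translate y1 y2 f) = translate y1 y2 (coef1 f).
Proof.
  apply state_ext; intros. unfold coef1, translate.
  repeat (f_equal; try (apply shift_args; lia)).
Qed.
Lemma coef2_translate y1 y2 f : coef2 (translate y1 y2 f) = translate y1 y2 (coef2 f).
Proof.
  apply state_ext; intros. unfold coef2, translate.
  repeat (f_equal; try (apply shift_args; lia)).
Qed.
(** Moving the base point to the origin turns all lattice arguments into closed integers, so that
    computation alone identifies equal points. *)
Lemma translate0 (f : state) x1 x2 k : f x1 x2 k = translate x1 x2 f 0%Z 0%Z k.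
Proof. unfold translate; apply shift_args; lia. Qed.

Lemma U_coef1 f : U (coef1 f) = coef1 (U f).
Proof.
  apply state_ext; intros x1 x2 k.
  unfold Uwalk, sum4, coef1.
  replace (x1 - shift1 k - 1)%Z with (x1 - 1 - shift1 k)%Z by lia.
  replace (x1 - shift1 k + 1)%Z with (x1 + 1 - shift1 k)%Z by lia.
  replace (x2 - shift2 k - 1)%Z with (x2 - 1 - shift2 k)%Z by lia.
  replace (x2 - shift2 k + 1)%Z with (x2 + 1 - shift2 k)%Z by lia.
  ring.
Qed.
Lemma U_dcoef1 f : U (dcoef1 f) = dcoef1 (U f).
Proof.
  apply state_ext; intros x1 x2 k.
  unfold Uwalk, sum4, dcoef1.
  replace (x1 - shift1 k - 1)%Z with (x1 - 1 - shift1 k)%Z by lia.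
  replace (x1 - shift1 k + 1)%Z with (x1 + 1 - shift1 k)%Z by lia.
  replace (x2 - shift2 k - 1)%Z with (x2 - 1 - shift2 k)%Z by lia.
  replace (x2 - shift2 k + 1)%Z with (x2 + 1 - shift2 k)%Z by lia.
  ring.
Qed.
Lemma U_coef2 f : U (coef2 f) = coef2 (U f).
Proof.
  apply state_ext; intros x1 x2 k.
  unfold Uwalk, sum4, coef2.
  replace (x1 - shift1 k - 1)%Z with (x1 - 1 - shift1 k)%Z by lia.
  replace (x1 - shift1 k + 1)%Z with (x1 + 1 - shift1 k)%Z by lia.
  replace (x2 - shift2 k - 1)%Z with (x2 - 1 - shift2 k)%Z by lia.
  replace (x2 - shift2 k + 1)%Z with (x2 + 1 - shift2 k)%Z by lia.
  ring.
Qed.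

(** * Inversion of the walk and the Cayley-Hamilton relation *)

Lemma lt4_cases (P : nat -> Prop) :
  P 0%nat -> P 1%nat -> P 2%nat -> P 3%nat -> forall k, (k < 4)%nat -> P k.
Proof.
  intros H0 H1 H2 H3 [|[|[|[|k]]]] Hk; try assumption; lia.
Qed.

Lemma Uinv_U f : state_eq (Uinv (U f)) f.
Proof.
  intros x1 x2 k Hk.
  rewrite (translate0 (Uinv (U f))), (translate0 f), <- Uinv_translate, <- U_translate.
  generalize (translate x1 x2 f); intro g. clear f x1 x2.
  revert k Hk; apply lt4_cases;
  unfold Uinv, Uwalk, sum4, F4; cbn -[Rdiv];
  apply Cpx_eq; cbn -[Rdiv]; field.
Qed.

(* Cayley-Hamilton multiplied by U^-2, which keeps the expansion to words of length two. *)
Lemma cayley_hamilton_sym f :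
  state_eq (sadd (U (U f)) (sadd (coef2 f) (coef1 (Uinv f))))
           (sadd (coef1 (U f)) (smul Ci (Uinv (Uinv f)))).
Proof.
  intros x1 x2 k Hk. apply Csub_eq0.
  unfold sadd, smul.
  rewrite (translate0 (U (U f))), (translate0 (coef2 f)), (translate0 (coef1 (Uinv f))),
     (translate0 (coef1 (U f))), (translate0 (Uinv (Uinv f))).
  repeat rewrite <- ?U_translate, <- ?coef2_translate, <- ?coef1_translate, <- ?Uinv_translate.
  generalize (translate x1 x2 f); intro g. clear f x1 x2.
  revert k Hk; apply lt4_cases;
  unfold coef1, coef2, Uinv, Uwalk, sum4, F4; cbn -[Rdiv];
  apply Cpx_eq; cbn -[Rdiv]; field.
Qed.

(** [U] reads only the first four components, so the images agree at every index, junk included. *)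
Lemma U_state_eq f g : state_eq f g -> U f = U g.
Proof.
  intro H; apply state_ext; intros; unfold Uwalk, sum4.
  rewrite !H by lia; reflexivity.
Qed.
Lemma Uinv_state_eq f g : state_eq f g -> Uinv f = Uinv g.
Proof.
  intro H; apply state_ext; intros; unfold Uinv, sum4.
  rewrite !H by lia; reflexivity.
Qed.
Lemma coef1_state_eq f g : state_eq f g -> state_eq (coef1 f) (coef1 g).
Proof.
  intros H x1 x2 k Hk; unfold coef1. rewrite !H by assumption; reflexivity.
Qed.

(** The symmetric form at [U (U f)], with the inverses cancelled. *)
Lemma cayley_hamilton f :
  state_eq (sadd (U (U (U (U f)))) (sadd (coef2 (U (U f))) (coef1 (U f))))
           (sadd (coef1 (U (U (U f)))) (smul Ci f)).
Proof.
  intros x1 x2 k Hk.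
  pose proof (cayley_hamilton_sym (U (U f)) x1 x2 k Hk) as H.
  rewrite (Uinv_state_eq _ _ (Uinv_U (U f))) in H.
  unfold sadd, smul in *.
  rewrite (coef1_state_eq _ _ (Uinv_U (U f)) x1 x2 k Hk) in H.
  rewrite (Uinv_U f x1 x2 k Hk) in H. exact H.
Qed.

(** * Commutators with [Y] and the drift *)

Lemma RtoC_add a b : RtoC (a + b) = Cadd (RtoC a) (RtoC b).
Proof. apply Cpx_eq; simpl; ring. Qed.

Lemma RtoC_opp a : RtoC (- a) = Copp (RtoC a).
Proof. apply Cpx_eq; simpl; ring. Qed.
Lemma RtoC_1 : RtoC 1 = Cone.
Proof. reflexivity. Qed.

Lemma Y_coef1 f : Y (coef1 f) = sadd (coef1 (Y f)) (dcoef1 f).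
Proof.
  apply state_ext; intros x1 x2 k. unfold Y, coef1, dcoef1, sadd.
  replace (x1 - 1 + x2)%Z with (x1 + x2 + (-1))%Z by lia.
  replace (x1 + (x2 - 1))%Z with (x1 + x2 + (-1))%Z by lia.
  replace (x1 + 1 + x2)%Z with (x1 + x2 + 1)%Z by lia.
  replace (x1 + (x2 + 1))%Z with (x1 + x2 + 1)%Z by lia.
  rewrite !plus_IZR.
  apply Cpx_eq; simpl; ring.
Qed.

(** The translations in [coef2] preserve x1 + x2. *)
Lemma Y_coef2 f : Y (coef2 f) = coef2 (Y f).
Proof.
  apply state_ext; intros x1 x2 k. unfold Y, coef2.
  replace (x1 - 1 + (x2 + 1))%Z with (x1 + x2)%Z by lia.
  replace (x1 + 1 + (x2 - 1))%Z with (x1 + x2)%Z by lia.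
  ring.
Qed.

Notation orbit psi n := (Nat.iter n U psi).

(* For a polynomial relation sum_j c_j U^j = 0 with scalar coefficients this is
   sum_j c_j sum_(0 <= b < j) U^b Y a_(n+j-b) + sum_j (n + j) [Y, c_j] a_(n+j).
   The increment drift (n+1) - U (drift n) telescopes to
   Y (sum_j c_j U^j) a_(n+1) - (sum_j c_j U^j) Y a_(n+1) = 0, so drift n = U^n (drift 0)
   is bounded although its last sum carries the factors n + j. *)
Definition drift (psi : state) (n : nat) : state :=
  let a m := orbit psi (m + n)%nat in
  let h m := Y (a m) in
  let s f := smul (RtoC (-1)) f in
  sadd (sadd (h 4%nat) (sadd (U (h 3%nat)) (sadd (U (U (h 2%nat))) (U (U (U (h 1%nat)))))))
 (sadd (s (coef1 (sadd (h 3%nat) (sadd (U (h 2%nat)) (U (U (h 1%nat)))))))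
 (sadd (coef2 (sadd (h 2%nat) (U (h 1%nat))))
 (sadd (coef1 (h 1%nat))
 (sadd (smul (RtoC (- INR (3 + n))) (dcoef1 (a 3%nat)))
       (smul (RtoC (INR (1 + n))) (dcoef1 (a 1%nat))))))).

Lemma drift_step psi n : state_eq (drift psi (S n)) (U (drift psi n)).
Proof.
  intros x1 x2 k Hk.
  pose proof (cayley_hamilton (Y (orbit psi (S n))) x1 x2 k Hk) as H1.
  pose proof (cayley_hamilton (orbit psi (S n)) x1 x2 k Hk) as H2.
  (* With a = a_(n+1), [H1] is the relation applied to Y a; multiplying [H2] by x1 + x2 applies Y to
     the relation for a instead. *)
  unfold sadd at 1 3 in H2. apply (f_equal (Cmul (RtoC (IZR (x1 + x2))))) in H2.
  assert (H2' : sadd (Y (U (U (U (U (orbit psi (S n)))))))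
     (sadd (Y (coef2 (U (U (orbit psi (S n)))))) (Y (coef1 (U (orbit psi (S n)))))) x1 x2 k
     = sadd (Y (coef1 (U (U (U (orbit psi (S n))))))) (smul Ci (Y (orbit psi (S n)))) x1 x2 k).
  { unfold sadd, smul, Y. unfold sadd, smul in H2.
    set (c := RtoC _) in *.
    match type of H2 with ?l = ?r => transitivity l; [ring | rewrite H2; ring] end. }
  clear H2. rewrite Y_coef2, !Y_coef1 in H2'.
  unfold drift.
  repeat rewrite ?U_add, ?U_mul, ?U_coef1, ?U_coef2, ?U_dcoef1.
  repeat rewrite ?coef1_add, ?coef2_add.
  change (orbit psi (4 + S n)) with (U (U (U (U (orbit psi (S n)))))).
  change (orbit psi (3 + S n)) with (U (U (U (orbit psi (S n))))).
  change (orbit psi (2 + S n)) with (U (U (orbit psi (S n)))).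
  change (orbit psi (1 + S n)) with (U (orbit psi (S n))).
  change (orbit psi (4 + n)) with (U (U (U (orbit psi (S n))))).
  change (orbit psi (3 + n)) with (U (U (orbit psi (S n)))).
  change (orbit psi (2 + n)) with (U (orbit psi (S n))).
  change (orbit psi (1 + n)) with (orbit psi (S n)).
  generalize dependent (orbit psi (S n)); intros a H1 H2.
  replace (3 + S n)%nat with (S (3 + n)) by lia.
  replace (1 + S n)%nat with (S (1 + n)) by lia.
  rewrite !S_INR.
  unfold sadd, smul in *.
  apply Csub_eq0.
  (* The increment of the drift equals the relation under Y minus the relation on Y a, formally in
     the values of the states; both vanish. *)
  match type of H1 with ?l = ?r => match type of H2 with ?l' = ?r' =>
    transitivity (Csub (Csub l' r') (Csub l r)) end end.
  - change (RtoC (-1)) with (RtoC (- (1))). rewrite !RtoC_opp, !RtoC_add, RtoC_1.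
    clear H1 H2.
    repeat match goal with |- context [?f x1 x2 k] => generalize (f x1 x2 k); intro end.
    generalize (RtoC (INR (3+n))) (RtoC (INR n)); intros.
    ring.
  - rewrite H1, H2; ring.
Qed.

(** * Null sequences and bounded sequences *)

Definition cv0 (u : nat -> Cpx) : Prop :=
  forall eps, 0 < eps -> exists N, forall n, (N <= n)%nat -> Cnorm2 (u n) < eps.
Definition bdd (u : nat -> Cpx) : Prop := exists M, forall n, Cnorm2 (u n) <= M.

Lemma cv0_ext u v : (forall n, u n = v n) -> cv0 u -> cv0 v.
Proof.
  intros H Hu eps He. destruct (Hu eps He) as [N HN]. exists N; intros n Hn.
  rewrite <- H; auto.
Qed.
Lemma cv0_add u v : cv0 u -> cv0 v -> cv0 (fun n => Cadd (u n) (v n)).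
Proof.
  intros Hu Hv eps He.
  destruct (Hu (eps/4)) as [N1 H1]; [lra|]. destruct (Hv (eps/4)) as [N2 H2]; [lra|].
  exists (N1 + N2)%nat; intros n Hn.
  specialize (H1 n ltac:(lia)); specialize (H2 n ltac:(lia)).
  pose proof (Cnorm2_add (u n) (v n)); lra.
Qed.
Lemma cv0_mul c u : cv0 u -> cv0 (fun n => Cmul c (u n)).
Proof.
  intros Hu eps He. pose proof (Cnorm2_ge0 c).
  destruct (Hu (eps / (Cnorm2 c + 1))) as [N HN]; [apply Rdiv_lt_0_compat; lra|].
  exists N; intros n Hn; specialize (HN n Hn). rewrite Cnorm2_mul.
  pose proof (Cnorm2_ge0 (u n)).
  apply (Rmult_lt_compat_l (Cnorm2 c + 1)) in HN; [|lra].
  replace ((Cnorm2 c + 1) * (eps / (Cnorm2 c + 1))) with eps in HN by (field; lra).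
  nra.
Qed.
Lemma cv0_shift m u : cv0 u -> cv0 (fun n => u (m + n)%nat).
Proof.
  intros Hu eps He. destruct (Hu eps He) as [N HN]. exists N; intros; apply HN; lia.
Qed.
Lemma cv0_unshift m u : cv0 (fun n => u (m + n)%nat) -> cv0 u.
Proof.
  intros Hu eps He. destruct (Hu eps He) as [N HN]. exists (m + N)%nat; intros n Hn.
  replace n with (m + (n - m))%nat by lia. apply HN; lia.
Qed.
Lemma bdd_ext u v : (forall n, u n = v n) -> bdd u -> bdd v.
Proof. intros H [M HM]; exists M; intro; rewrite <- H; auto. Qed.
Lemma bdd_add u v : bdd u -> bdd v -> bdd (fun n => Cadd (u n) (v n)).
Proof.
  intros [M HM] [M' HM']; exists (2 * M + 2 * M'); intro n.
  pose proof (Cnorm2_add (u n) (v n)). specialize (HM n); specialize (HM' n). lra.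
Qed.
Lemma bdd_mul c u : bdd u -> bdd (fun n => Cmul c (u n)).
Proof.
  intros [M HM]; exists (Cnorm2 c * M); intro n. rewrite Cnorm2_mul.
  apply Rmult_le_compat_l; auto using Cnorm2_ge0.
Qed.
Lemma bdd_sub u v : bdd u -> bdd v -> bdd (fun n => Csub (u n) (v n)).
Proof.
  intros Hu Hv. apply (bdd_ext (fun n => Cadd (u n) (Cmul (RtoC (-1)) (v n)))).
  - intro; apply Cpx_eq; simpl; ring.
  - apply bdd_add; [|apply bdd_mul]; assumption.
Qed.
Lemma bdd_cv0 u : bdd (fun n => Cmul (RtoC (INR (S n))) (u n)) -> cv0 u.
Proof.
  intros [M HM] eps He.
  assert (0 <= M) by (eapply Rle_trans; [apply Cnorm2_ge0 | apply (HM 0%nat)]).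
  (* Here N eps > M + 1, so a value [Cnorm2 (u n)] of at least eps with n >= N would give (n+1)^2
     [Cnorm2 (u n)] >= N eps > M. *)
  destruct (archimed_cor1 (eps / (M + 1))) as [N [HN HN0]]; [apply Rdiv_lt_0_compat; lra|].
  exists N; intros n Hn. specialize (HM n). rewrite Cnorm2_mul in HM.
  unfold Cnorm2 at 1 in HM; cbn [re im RtoC] in HM.
  assert (HI : INR N <= INR (S n)) by (apply le_INR; lia).
  assert (HN1 : 1 <= INR N) by (apply (le_INR 1); lia).
  assert (M + 1 < eps * INR N).
  { apply (Rmult_lt_compat_r (INR N * (M + 1))) in HN; [|nra].
    replace (/ INR N * (INR N * (M + 1))) with (M + 1) in HN by (field; lra).
    replace (eps / (M + 1) * (INR N * (M + 1))) with (eps * INR N) in HN by (field; lra).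
    exact HN. }
  pose proof (Cnorm2_ge0 (u n)).
  destruct (Rlt_le_dec (Cnorm2 (u n)) eps) as [|Hc]; [assumption|exfalso].
  assert (INR N <= INR (S n) * INR (S n)) by nra.
  assert (eps * INR N <= Cnorm2 (u n) * (INR (S n) * INR (S n))) by nra.
  nra.
Qed.

(** * Sums over finite sets of lattice points and the isometry property *)

Definition pt : Type := (Z * Z)%type.
Definition pt_dec (p q : pt) : {p = q} + {p <> q}.
Proof. decide equality; apply Z.eq_dec. Defined.
Definition ptadd (p q : pt) : pt := ((fst p + fst q)%Z, (snd p + snd q)%Z).

Definition lsum {A : Type} (g : A -> R) (l : list A) : R := fold_right (fun p s => g p + s) 0 l.

Lemma lsum_app {A} (g : A -> R) l l' : lsum g (l ++ l') = lsum g l + lsum g l'.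
Proof. induction l as [|a l IH]; simpl; [ring|rewrite IH; ring]. Qed.
Lemma lsum_map {A B} (g : B -> R) (h : A -> B) l : lsum g (map h l) = lsum (fun p => g (h p)) l.
Proof. induction l as [|a l IH]; simpl; [ring|rewrite IH; ring]. Qed.
Lemma lsum_add {A} (g h : A -> R) l : lsum (fun p => g p + h p) l = lsum g l + lsum h l.
Proof. induction l as [|a l IH]; simpl; [ring|rewrite IH; ring]. Qed.
Lemma lsum_scal {A} c (g : A -> R) l : lsum (fun p => c * g p) l = c * lsum g l.
Proof. induction l as [|a l IH]; simpl; [ring|rewrite IH; ring]. Qed.
Lemma lsum_le {A} (g h : A -> R) l : (forall p, In p l -> g p <= h p) -> lsum g l <= lsum h l.
Proof.
  induction l as [|a l IH]; simpl; intro H; [lra|].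
  apply Rplus_le_compat; [apply H; auto | apply IH; intros; apply H; auto].
Qed.
Lemma lsum_ge0 {A} (g : A -> R) l : (forall p, 0 <= g p) -> 0 <= lsum g l.
Proof. intro H; induction l as [|a l IH]; simpl; [lra|]. specialize (H a); lra. Qed.
Lemma lsum_incl {A} (g : A -> R) l l' : (forall p, 0 <= g p) -> NoDup l -> incl l l' ->
  lsum g l <= lsum g l'.
Proof.
  intros Hg Hl; revert l'; induction Hl as [|a l Ha Hl IH]; intros l' Hi.
  - apply lsum_ge0; assumption.
  - destruct (in_split a l') as [l1 [l2 E]]; [apply Hi; left; reflexivity|]. subst l'.
    rewrite lsum_app; simpl.
    assert (lsum g l <= lsum g (l1 ++ l2)).
    { apply IH. intros x Hx. specialize (Hi x (or_intror Hx)).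
      apply in_app_iff in Hi. apply in_app_iff. destruct Hi as [|[E|]]; auto.
      subst; contradiction. }
    rewrite lsum_app in H. lra.
Qed.

Definition sn2 (f : state) (p : pt) : R := vnorm2 (f (fst p) (snd p)).
(** Arbitrary finite sets replace the boxes of [in_l2], since they are stable under translation and
    boxes centred at the origin are not. *)
Definition l2le (f : state) (M : R) : Prop := forall l, NoDup l -> lsum (sn2 f) l <= M.

Lemma vnorm2_ge0 v : 0 <= vnorm2 v.
Proof.
  unfold vnorm2, rsum4.
  pose proof (Cnorm2_ge0 (v 0%nat)); pose proof (Cnorm2_ge0 (v 1%nat));
  pose proof (Cnorm2_ge0 (v 2%nat)); pose proof (Cnorm2_ge0 (v 3%nat)); lra.
Qed.
Lemma sn2_ge0 f p : 0 <= sn2 f p.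
Proof. apply vnorm2_ge0. Qed.
Lemma Cnorm2_le_vnorm2 v : forall k, (k < 4)%nat -> Cnorm2 (v k) <= vnorm2 v.
Proof.
  unfold vnorm2, rsum4.
  pose proof (Cnorm2_ge0 (v 0%nat)); pose proof (Cnorm2_ge0 (v 1%nat));
  pose proof (Cnorm2_ge0 (v 2%nat)); pose proof (Cnorm2_ge0 (v 3%nat)).
  apply lt4_cases; lra.
Qed.
Lemma vnorm2_add v w : vnorm2 (fun k => Cadd (v k) (w k)) <= 2 * vnorm2 v + 2 * vnorm2 w.
Proof.
  unfold vnorm2, rsum4.
  pose proof (Cnorm2_add (v 0%nat) (w 0%nat)); pose proof (Cnorm2_add (v 1%nat) (w 1%nat));
  pose proof (Cnorm2_add (v 2%nat) (w 2%nat)); pose proof (Cnorm2_add (v 3%nat) (w 3%nat)).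
  lra.
Qed.
Lemma vnorm2_mul c v : vnorm2 (fun k => Cmul c (v k)) = Cnorm2 c * vnorm2 v.
Proof. unfold vnorm2, rsum4; rewrite !Cnorm2_mul; ring. Qed.
Lemma vnorm2_ext v w : (forall k, (k < 4)%nat -> v k = w k) -> vnorm2 v = vnorm2 w.
Proof. intro H; unfold vnorm2, rsum4; rewrite !H by lia; reflexivity. Qed.

Definition Fvec (v : vec) : vec := fun k => sum4 (fun l => Cmul (F4 k l) (v l)).
(** This is the unitarity of [F4], checked on real and imaginary parts. *)
Lemma vnorm2_Fvec v : vnorm2 (Fvec v) = vnorm2 v.
Proof.
  unfold vnorm2, rsum4, Fvec, sum4, F4.
  generalize (v 0%nat) (v 1%nat) (v 2%nat) (v 3%nat); intros [] [] [] [].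
  unfold Cnorm2; cbn -[Rdiv]. field.
Qed.

Definition spread (s : nat -> pt) (l : list pt) : list pt :=
  nodup pt_dec (map (ptadd (s 0%nat)) l ++ map (ptadd (s 1%nat)) l
                ++ map (ptadd (s 2%nat)) l ++ map (ptadd (s 3%nat)) l).

Lemma ptadd_inj s p q : ptadd s p = ptadd s q -> p = q.
Proof.
  destruct s, p, q; unfold ptadd; simpl; intro H; inversion H.
  f_equal; lia.
Qed.

Lemma NoDup_map_ptadd s l : NoDup l -> NoDup (map (ptadd s) l).
Proof.
  intro H; induction H as [|a l Ha Hl IH]; simpl; constructor; auto.
  intro Hi; apply in_map_iff in Hi; destruct Hi as [b [E Hb]].
  apply ptadd_inj in E; subst; contradiction.
Qed.

(* The four components may be translated independently, as long as the target set is
   enlarged to contain all four translates. *)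
Lemma lsum_spread (g : nat -> pt -> R) s l : (forall k p, 0 <= g k p) -> NoDup l ->
  lsum (fun p => rsum4 (fun k => g k (ptadd (s k) p))) l
  <= lsum (fun p => rsum4 (fun k => g k p)) (spread s l).
Proof.
  intros Hg Hl. unfold rsum4. rewrite !lsum_add.
  assert (H : forall k, (k < 4)%nat ->
     lsum (fun p => g k (ptadd (s k) p)) l <= lsum (g k) (spread s l)).
  { intros k Hk. rewrite <- (lsum_map (g k)). apply lsum_incl; auto using NoDup_map_ptadd.
    intros x Hx. apply nodup_In. rewrite !in_app_iff.
    revert k Hk Hx; apply (lt4_cases (fun k => In x (map (ptadd (s k)) l) -> _)); tauto. }
  repeat apply Rplus_le_compat; apply H; lia.
Qed.

Lemma NoDup_spread s l : NoDup (spread s l).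
Proof. apply NoDup_nodup. Qed.

(** Component k of [U f] at p is component k of F4 f at p - alpha_k: a translation of each component
    after a pointwise isometry. *)
Lemma l2le_U f M : l2le f M -> l2le (U f) M.
Proof.
  intros H l Hl.
  set (s := fun k => ((- shift1 k)%Z, (- shift2 k)%Z)).
  set (g := fun k (p : pt) => Cnorm2 (Fvec (f (fst p) (snd p)) k)).
  apply Rle_trans with (lsum (fun p => rsum4 (fun k => g k (ptadd (s k) p))) l).
  - right. f_equal. apply functional_extensionality; intro p.
    unfold sn2, vnorm2. f_equal. apply functional_extensionality; intro k.
    unfold g, Fvec, Uwalk, ptadd, s; cbn [fst snd]. f_equal. f_equal.
    apply functional_extensionality; intro j. f_equal. apply shift_args; lia.
  - eapply Rle_trans; [apply lsum_spread; auto|].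
    + intros; apply Cnorm2_ge0.
    + eapply Rle_trans; [|apply (H (spread s l)), NoDup_spread].
      right. f_equal. apply functional_extensionality; intro p.
      apply (vnorm2_Fvec (f (fst p) (snd p))).
Qed.

(** The same shifts read backwards: component k of F4 f at p is component k of [U f] at p + alpha_k.
    This direction bounds the modulus of an eigenvalue from below. *)
Lemma U_l2le f M : l2le (U f) M -> l2le f M.
Proof.
  intros H l Hl.
  set (s := fun k => (shift1 k, shift2 k)).
  set (g := fun k (p : pt) => Cnorm2 (U f (fst p) (snd p) k)).
  apply Rle_trans with (lsum (fun p => rsum4 (fun k => g k (ptadd (s k) p))) l).
  - right. f_equal. apply functional_extensionality; intro p.
    unfold sn2. rewrite <- vnorm2_Fvec. unfold vnorm2.
    f_equal. apply functional_extensionality; intro k.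
    unfold g, Fvec, Uwalk, ptadd, s; cbn [fst snd]. f_equal. f_equal.
    apply functional_extensionality; intro j. f_equal. apply shift_args; lia.
  - eapply Rle_trans; [apply lsum_spread; auto|].
    + intros; apply Cnorm2_ge0.
    + apply (H (spread s l)), NoDup_spread.
Qed.

Lemma l2le_orbit f M n : l2le f M -> l2le (orbit f n) M.
Proof. intro H; induction n; simpl; auto using l2le_U. Qed.

Lemma l2le_point f M x1 x2 : l2le f M -> vnorm2 (f x1 x2) <= M.
Proof.
  intro H. specialize (H [(x1, x2)]). unfold lsum, sn2 in H; simpl in H.
  rewrite <- (Rplus_0_r (vnorm2 _)). apply H. repeat constructor; auto.
Qed.

(** * Finitely supported states *)

Definition fsupp (f : state) : Prop :=
  exists r : Z, forall x1 x2 k, (r < Z.abs x1 + Z.abs x2)%Z -> f x1 x2 k = C0.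

Lemma fsupp_add f g : fsupp f -> fsupp g -> fsupp (sadd f g).
Proof.
  intros [r Hr] [r' Hr']; exists (Z.max r r'); intros. unfold sadd.
  rewrite Hr, Hr' by lia. ring.
Qed.
Lemma fsupp_mul c f : fsupp f -> fsupp (smul c f).
Proof. intros [r Hr]; exists r; intros; unfold smul; rewrite Hr by lia; ring. Qed.
Lemma fsupp_Y f : fsupp f -> fsupp (Y f).
Proof. intros [r Hr]; exists r; intros; unfold Y; rewrite Hr by lia; ring. Qed.
Lemma fsupp_U f : fsupp f -> fsupp (U f).
Proof.
  intros [r Hr]; exists (r + 2)%Z; intros x1 x2 k H. unfold Uwalk, sum4.
  assert (-1 <= shift1 k <= 1 /\ -1 <= shift2 k <= 1)%Z
    by (destruct k as [|[|[|[|k]]]]; simpl; lia).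
  rewrite !Hr by lia. ring.
Qed.
Lemma fsupp_coef1 f : fsupp f -> fsupp (coef1 f).
Proof.
  intros [r Hr]; exists (r + 2)%Z; intros x1 x2 k H. unfold coef1.
  rewrite !Hr by lia. ring.
Qed.
Lemma fsupp_coef2 f : fsupp f -> fsupp (coef2 f).
Proof.
  intros [r Hr]; exists (r + 2)%Z; intros x1 x2 k H. unfold coef2.
  rewrite !Hr by lia. ring.
Qed.
Lemma fsupp_dcoef1 f : fsupp f -> fsupp (dcoef1 f).
Proof.
  intros [r Hr]; exists (r + 2)%Z; intros x1 x2 k H. unfold dcoef1.
  rewrite !Hr by lia. ring.
Qed.
Lemma fsupp_orbit f n : fsupp f -> fsupp (orbit f n).
Proof. intro H; induction n; simpl; auto using fsupp_U. Qed.

Definition zrange (N : nat) : list Z := map (fun i => (Z.of_nat i - Z.of_nat N)%Z) (seq 0 (S (2 * N))).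
Definition box (N : nat) : list pt := list_prod (zrange N) (zrange N).

Lemma In_box N x1 x2 : (Z.abs x1 <= Z.of_nat N)%Z -> (Z.abs x2 <= Z.of_nat N)%Z ->
  In (x1, x2) (box N).
Proof.
  assert (H : forall x, (Z.abs x <= Z.of_nat N)%Z -> In x (zrange N)).
  { intros x Hx. apply in_map_iff. exists (Z.to_nat (x + Z.of_nat N)).
    split; [lia|]. apply in_seq; lia. }
  intros; apply in_prod; auto.
Qed.

Lemma fsupp_l2le f : fsupp f -> exists M, l2le f M.
Proof.
  intros [r Hr]. set (N := Z.to_nat r). exists (lsum (sn2 f) (box N)).
  intros l Hl.
  apply Rle_trans with (lsum (sn2 f) (filter (fun p => (Z.abs (fst p) + Z.abs (snd p) <=? r)%Z) l)).
  - clear Hl. induction l as [|[x1 x2] l IH]; simpl; [lra|].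
    destruct (Z.leb_spec (Z.abs x1 + Z.abs x2) r) as [|Hx]; simpl; [lra|].
    replace (sn2 f (x1, x2)) with 0; [lra|].
    unfold sn2, vnorm2, rsum4; simpl. rewrite !Hr by lia. unfold Cnorm2; simpl; ring.
  - apply lsum_incl; [apply sn2_ge0 | apply NoDup_filter; assumption|].
    intros [x1 x2] Hx; apply filter_In in Hx; destruct Hx as [_ Hx]; simpl in Hx.
    apply Z.leb_le in Hx. apply In_box; unfold N; lia.
Qed.

(** * Pointwise bounds along orbits and decay of the critical symbol *)

Definition pointwise (P : (nat -> Cpx) -> Prop) (g : nat -> state) : Prop :=
  forall x1 x2 k, (k < 4)%nat -> P (fun n => g n x1 x2 k).

Lemma pbdd_add f g : pointwise bdd f -> pointwise bdd g -> pointwise bdd (fun n => sadd (f n) (g n)).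
Proof. intros Hf Hg x1 x2 k Hk. apply bdd_add; auto. Qed.
Lemma pbdd_mul c f : pointwise bdd f -> pointwise bdd (fun n => smul c (f n)).
Proof. intros Hf x1 x2 k Hk. apply bdd_mul; auto. Qed.
(** [Y] is unbounded on l2, but at a fixed point it is a fixed scalar; hence the use of pointwise
    bounds. *)
Lemma pbdd_Y f : pointwise bdd f -> pointwise bdd (fun n => Y (f n)).
Proof. intros Hf x1 x2 k Hk. apply bdd_mul; auto. Qed.
Lemma pbdd_U f : pointwise bdd f -> pointwise bdd (fun n => U (f n)).
Proof.
  intros Hf x1 x2 k Hk. unfold Uwalk, sum4.
  repeat (apply bdd_add || apply bdd_mul || (apply Hf; lia)).
Qed.
Lemma pbdd_coef1 f : pointwise bdd f -> pointwise bdd (fun n => coef1 (f n)).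
Proof.
  intros Hf x1 x2 k Hk. unfold coef1.
  repeat (apply bdd_add || apply bdd_mul || (apply Hf; lia)).
Qed.
Lemma pbdd_coef2 f : pointwise bdd f -> pointwise bdd (fun n => coef2 (f n)).
Proof.
  intros Hf x1 x2 k Hk. unfold coef2.
  repeat (apply bdd_add || apply bdd_mul || (apply Hf; lia)).
Qed.
Lemma pbdd_dcoef1 f : pointwise bdd f -> pointwise bdd (fun n => dcoef1 (f n)).
Proof.
  intros Hf x1 x2 k Hk. unfold dcoef1.
  repeat (apply bdd_mul || apply bdd_sub || apply bdd_add || (apply Hf; lia)).
Qed.

Lemma orbit_pbdd psi m M : l2le psi M -> pointwise bdd (fun n => orbit psi (m + n)).
Proof.
  intros H x1 x2 k Hk. exists M; intro n.
  eapply Rle_trans; [apply Cnorm2_le_vnorm2, Hk|].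
  apply l2le_point, l2le_orbit, H.
Qed.

Lemma drift_orbit psi n : state_eq (drift psi n) (orbit (drift psi 0) n).
Proof.
  induction n as [|n IH]; [intros ? ? ? _; reflexivity|].
  intros x1 x2 k Hk. rewrite (drift_step psi n x1 x2 k Hk), (U_state_eq _ _ IH). reflexivity.
Qed.

Lemma fsupp_drift0 psi : fsupp psi -> fsupp (drift psi 0).
Proof.
  intro H. unfold drift.
  repeat (apply fsupp_orbit || apply fsupp_coef1 || apply fsupp_coef2 || apply fsupp_dcoef1
          || apply fsupp_U || apply fsupp_Y || apply fsupp_mul || apply fsupp_add || exact H).
Qed.

Lemma drift_pbdd psi : fsupp psi -> pointwise bdd (drift psi).
Proof.
  intros H x1 x2 k Hk. destruct (fsupp_l2le _ (fsupp_drift0 psi H)) as [M HM].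
  eapply bdd_ext; [intro n; symmetry; apply (drift_orbit psi n x1 x2 k Hk)|].
  apply (orbit_pbdd _ 0 M HM x1 x2 k Hk).
Qed.

Lemma dcoef1_orbit_diff_cv0 psi : fsupp psi ->
  pointwise cv0 (fun n => sadd (dcoef1 (orbit psi (2 + n)))
                            (smul (RtoC (-1)) (dcoef1 (orbit psi n)))).
Proof.
  (* The drift involves a_(n+3) and a_(n+1), that is, the claim with n replaced by n + 1. It
     suffices to bound n + 1 times the difference. *)
  intros H x1 x2 k Hk. apply (cv0_unshift 1). apply bdd_cv0.
  destruct (fsupp_l2le _ H) as [M HM].
  pose proof (fun m => orbit_pbdd psi m M HM) as Ha.
  pose proof (fun m => pbdd_Y _ (Ha m)) as Hh.
  set (h m n := Y (orbit psi (m + n))) in *.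
  (* [W] is the part of [drift psi n] without growing factors. *)
  set (W n := sadd (sadd (h 4%nat n) (sadd (U (h 3%nat n)) (sadd (U (U (h 2%nat n))) (U (U (U (h 1%nat n)))))))
 (sadd (smul (RtoC (-1)) (coef1 (sadd (h 3%nat n) (sadd (U (h 2%nat n)) (U (U (h 1%nat n)))))))
 (sadd (coef2 (sadd (h 2%nat n) (U (h 1%nat n)))) (coef1 (h 1%nat n))))).
  assert (HW : pointwise bdd W).
  { unfold W. repeat (apply Hh || apply pbdd_U || apply pbdd_coef1 || apply pbdd_coef2
      || apply pbdd_mul || apply pbdd_add). }
  (* [W] minus the drift is (n+3) de1 a_(n+3) - (n+1) de1 a_(n+1); subtracting 2 de1 a_(n+3) leaves
     the common factor n + 1. *)
  pose proof (bdd_sub _ _ (bdd_sub _ _ (HW x1 x2 k Hk) (drift_pbdd psi H x1 x2 k Hk))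
     (bdd_mul (RtoC 2) _ (pbdd_dcoef1 _ (Ha 3%nat) x1 x2 k Hk))) as Hb.
  eapply bdd_ext; [|exact Hb]. intro n; cbv beta.
  unfold drift. fold (h 4%nat n) (h 3%nat n) (h 2%nat n) (h 1%nat n).
  change (2 + (1 + n))%nat with (3 + n)%nat.
  unfold W, sadd, smul.
  replace (3 + n)%nat with (S (S (S n))) by lia. replace (1 + n)%nat with (S n) by lia.
  rewrite !S_INR. change (RtoC (-1)) with (RtoC (- (1))). change 2 with (1 + 1).
  rewrite !RtoC_opp, !RtoC_add, RtoC_1.
  repeat match goal with |- context [?f x1 x2 k] => generalize (f x1 x2 k); intro end.
  generalize (RtoC (INR n)); intros. ring.
Qed.

Lemma pcv0_add f g : pointwise cv0 f -> pointwise cv0 g -> pointwise cv0 (fun n => sadd (f n) (g n)).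
Proof. intros Hf Hg x1 x2 k Hk. apply cv0_add; auto. Qed.
Lemma pcv0_mul c f : pointwise cv0 f -> pointwise cv0 (fun n => smul c (f n)).
Proof. intros Hf x1 x2 k Hk. apply cv0_mul; auto. Qed.
Lemma pcv0_coef1 f : pointwise cv0 f -> pointwise cv0 (fun n => coef1 (f n)).
Proof.
  intros Hf x1 x2 k Hk. unfold coef1.
  repeat (apply cv0_add || apply cv0_mul || (apply Hf; lia)).
Qed.
Lemma pcv0_coef2 f : pointwise cv0 f -> pointwise cv0 (fun n => coef2 (f n)).
Proof.
  intros Hf x1 x2 k Hk. unfold coef2.
  repeat (apply cv0_add || apply cv0_mul || (apply Hf; lia)).
Qed.

(** Division by U^2 - 1 writes the Cayley-Hamilton polynomial as (U^2 - 1)(U^2 - e1 U + 1 + e2) + (1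
    - i + e2). On de1 a_n the whole vanishes and the first summand tends to 0, hence so does the
    remainder. *)
Lemma critical_orbit_cv0 psi : fsupp psi ->
  pointwise cv0 (fun n => sadd (smul (mkC 1 (-1)) (dcoef1 (orbit psi n)))
                               (coef2 (dcoef1 (orbit psi n)))).
Proof.
  intros H. pose proof (dcoef1_orbit_diff_cv0 psi H) as Hd.
  set (d n := sadd _ _) in Hd.
  assert (Hs : forall m, pointwise cv0 (fun n => d (m + n)%nat)).
  { intros m x1 x2 k Hk. apply (cv0_shift m (fun n => d n x1 x2 k)). auto. }
  assert (Hc : pointwise cv0 (fun n => smul (RtoC (-1)) (sadd (sadd (d (2 + n)%nat) (d (0+n)%nat))
     (sadd (smul (RtoC (-1)) (coef1 (d (1 + n)%nat))) (coef2 (d (0+n)%nat)))))).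
  { repeat (apply Hs || apply pcv0_coef1 || apply pcv0_coef2 || apply pcv0_mul || apply pcv0_add). }
  intros x1 x2 k Hk. eapply cv0_ext; [|apply (Hc x1 x2 k Hk)].
  intro n; cbv beta. clear Hc Hs Hd.
  pose proof (cayley_hamilton (dcoef1 (orbit psi n)) x1 x2 k Hk) as E.
  rewrite !U_dcoef1 in E.
  unfold d. change (0 + n)%nat with n.
  repeat rewrite ?coef1_add, ?coef2_add, ?coef1_mul, ?coef2_mul.
  change (orbit psi (2 + (2 + n))) with (U (U (U (U (orbit psi n))))).
  change (orbit psi (2 + (1 + n))) with (U (U (U (orbit psi n)))).
  change (orbit psi (2 + n)) with (U (U (orbit psi n))).
  change (orbit psi (1 + n)) with (U (orbit psi n)).
  unfold sadd, smul in *.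
  replace (mkC 1 (-1)) with (Csub Cone Ci) by (apply Cpx_eq; simpl; ring).
  change (RtoC (-1)) with (RtoC (- (1))). rewrite RtoC_opp, RtoC_1.
  revert E.
  repeat match goal with |- context [?f x1 x2 k] => generalize (f x1 x2 k); intro end.
  intro E. apply Csub_eq0.
  match type of E with ?l = ?r => transitivity (Csub r l) end.
  - ring.
  - rewrite E; ring.
Qed.

(** * Cancelling binomials in the translations *)

Definition scalar_l2 (g : nat -> Z -> Z -> Cpx) : Prop :=
  exists M, forall n l, NoDup l -> lsum (fun p => Cnorm2 (g n (fst p) (snd p))) l <= M.

(** In terms of the unit translations z and w, this is the binomial 1 - c z^(-a) w^(-b). *)
Definition lin (c : Cpx) (a b : Z) (g : nat -> Z -> Z -> Cpx) : nat -> Z -> Z -> Cpx :=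
  fun n x1 x2 => Csub (g n x1 x2) (Cmul c (g n (x1 + a)%Z (x2 + b)%Z)).

Lemma scalar_l2_lin c a b g : scalar_l2 g -> scalar_l2 (lin c a b g).
Proof.
  intros [M HM]. exists (2 * M + 2 * Cnorm2 c * M); intros n l Hl.
  set (G := fun p : pt => Cnorm2 (g n (fst p) (snd p))).
  apply Rle_trans with (lsum (fun p => 2 * G p + 2 * Cnorm2 c * G (ptadd (a, b) p)) l).
  - apply lsum_le; intros [x1 x2] _. unfold lin, G, ptadd; cbn [fst snd].
    unfold Csub. eapply Rle_trans; [apply Cnorm2_add|].
    replace (Cnorm2 (Copp _)) with (Cnorm2 c * Cnorm2 (g n (a + x1)%Z (b + x2)%Z)); [lra|].
    rewrite (Z.add_comm a), (Z.add_comm b), <- Cnorm2_mul. unfold Cnorm2; simpl; ring.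
  - rewrite lsum_add, !lsum_scal, <- (lsum_map G (ptadd (a, b))).
    pose proof (Cnorm2_ge0 c).
    assert (lsum G l <= M) by exact (HM n l Hl).
    assert (lsum G (map (ptadd (a, b)) l) <= M) by exact (HM n _ (NoDup_map_ptadd (a, b) l Hl)).
    apply Rplus_le_compat; apply Rmult_le_compat_l; lra.
Qed.

Definition line (a b x1 x2 : Z) (j : nat) : pt := ((x1 + Z.of_nat j * a)%Z, (x2 + Z.of_nat j * b)%Z).

Lemma NoDup_line a b x1 x2 K : (a <> 0 \/ b <> 0)%Z ->
  NoDup (map (line a b x1 x2) (seq 0 K)).
Proof.
  intro ab_neq0. apply NoDup_map_NoDup_ForallPairs; [|apply seq_NoDup].
  intros i j _ _ E. unfold line in E. injection E; intros; nia.
Qed.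

(** Iterating the asymptotic relation along the line gives g_n(x) - c^j g_n(x + j(a,b)) -> 0 with
    |c^j| = 1. The factor 2 comes from [Cnorm2_add], used in place of the triangle inequality. *)
Lemma line_step c a b g x1 x2 : Cnorm2 c = 1 ->
  (forall x1 x2, cv0 (fun n => lin c a b g n x1 x2)) ->
  forall j eps, 0 < eps -> exists N, forall n, (N <= n)%nat ->
   Cnorm2 (g n x1 x2) <= eps + 2 * Cnorm2 (g n (fst (line a b x1 x2 j)) (snd (line a b x1 x2 j))).
Proof.
  intros c_unit H j.
  set (G n j := g n (fst (line a b x1 x2 j)) (snd (line a b x1 x2 j))).
  assert (Hj : exists c', Cnorm2 c' = 1 /\ cv0 (fun n => Csub (g n x1 x2) (Cmul c' (G n j)))).
  { induction j as [|j [c' [Hc' IH]]].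
    - exists Cone; split; [unfold Cnorm2; simpl; ring|].
      apply (cv0_ext (fun n => C0)).
      + intro n; unfold G, line; cbn [fst snd].
        replace (x1 + Z.of_nat 0 * a)%Z with x1 by lia.
        replace (x2 + Z.of_nat 0 * b)%Z with x2 by lia. ring.
      + intros eps He; exists 0%nat; intros; unfold Cnorm2; simpl; lra.
    - exists (Cmul c' c); split; [rewrite Cnorm2_mul, Hc', c_unit; ring|].
      pose proof (cv0_add _ _ IH (cv0_mul c' _
         (H (fst (line a b x1 x2 j)) (snd (line a b x1 x2 j))))) as Hs.
      eapply cv0_ext; [|exact Hs]. intro n; cbv beta. unfold lin.
      fold (G n j).
      replace (g n (fst (line a b x1 x2 j) + a)%Z (snd (line a b x1 x2 j) + b)%Z) with (G n (S j)).
      + ring.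
      + unfold G, line; cbn [fst snd]. f_equal; lia. }
  destruct Hj as [c' [Hc' Hcv]]. intros eps He.
  destruct (Hcv (eps / 2)) as [N HN]; [lra|]. exists N; intros n Hn. specialize (HN n Hn).
  pose proof (Cnorm2_add (Csub (g n x1 x2) (Cmul c' (G n j))) (Cmul c' (G n j))) as Ha.
  replace (Cadd (Csub (g n x1 x2) (Cmul c' (G n j))) (Cmul c' (G n j))) with (g n x1 x2)
    in Ha by ring.
  rewrite (Cnorm2_mul c'), Hc' in Ha. unfold G in *. lra.
Qed.

Lemma lin_cancel c a b g : Cnorm2 c = 1 -> (a <> 0 \/ b <> 0)%Z -> scalar_l2 g ->
  (forall x1 x2, cv0 (fun n => lin c a b g n x1 x2)) ->
  forall x1 x2, cv0 (fun n => g n x1 x2).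
Proof.
  intros c_unit ab_neq0 [M HM] H x1 x2 eps He.
  (* [line_step] is summed over the first K points of the line; one N serves for all of them. *)
  assert (HK : forall K eta, 0 < eta -> exists N, forall n, (N <= n)%nat ->
    INR K * Cnorm2 (g n x1 x2) <= INR K * eta
      + 2 * lsum (fun p => Cnorm2 (g n (fst p) (snd p))) (map (line a b x1 x2) (seq 0 K))).
  { intros K eta Heta. induction K as [|K [N HN]].
    - exists 0%nat; intros; simpl; lra.
    - destruct (line_step c a b g x1 x2 c_unit H K eta Heta) as [N' HN'].
      exists (N + N')%nat; intros n Hn.
      specialize (HN n ltac:(lia)); specialize (HN' n ltac:(lia)).
      rewrite seq_S, map_app, lsum_app, S_INR. cbn [map lsum fold_right]. simpl plus.
      lra. }
  assert (HM0 : 0 <= M) by (apply (HM 0%nat []); constructor).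
  (* The sum over the line is at most M, so the squared modulus is at most eps/2 + 2M/K, which is
     below eps once K eps > 4M + 1. *)
  destruct (archimed_cor1 (eps / (4 * M + 1))) as [K [HK1 HK0]]; [apply Rdiv_lt_0_compat; lra|].
  destruct (HK K (eps / 2)) as [N HN]; [lra|]. exists N; intros n Hn. specialize (HN n Hn).
  pose proof (HM n _ (NoDup_line a b x1 x2 K ab_neq0)).
  assert (HI : 1 <= INR K) by (apply (le_INR 1); lia).
  apply (Rmult_lt_compat_r (INR K * (4 * M + 1))) in HK1; [|nra].
  replace (/ INR K * (INR K * (4 * M + 1))) with (4 * M + 1) in HK1 by (field; lra).
  replace (eps / (4 * M + 1) * (INR K * (4 * M + 1))) with (eps * INR K) in HK1 by (field; lra).
  destruct (Rlt_le_dec (Cnorm2 (g n x1 x2)) eps) as [|Hc]; [assumption|exfalso].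
  nra.
Qed.

(* With z, w the two unit translations, (1 - i + e2) de1 equals
   (1-i)/8 w (1 - w/z) (1 - z/w) (1 + z/w) (1 - i/(zw)); the factor mkC 4 4 is 8/(1-i),
   and evaluating at y2 + 1 removes the factor w. *)
Lemma critical_factor (g : nat -> state) n y1 y2 k :
  Cmul (mkC 4 4) (sadd (smul (mkC 1 (-1)) (dcoef1 (g n))) (coef2 (dcoef1 (g n))) y1 (y2 + 1)%Z k)
  = lin Cone 1 (-1) (lin Cone (-1) 1 (lin (Copp Cone) (-1) 1 (lin Ci 1 1
      (fun n x1 x2 => g n x1 x2 k)))) n y1 y2.
Proof.
  unfold lin, sadd, smul, coef2, dcoef1.
  generalize (g n); intro f.
  remember (fun i j => f (y1 + i)%Z (y2 + j)%Z k) as G eqn:EG.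
  assert (HG : forall a b i j, a = (y1 + i)%Z -> b = (y2 + j)%Z -> f a b k = G i j)
    by (intros; subst; reflexivity).
  clear EG.
  (* The offsets are read off by evaluating each argument, as a function of [y1] or [y2], at 0. With
     literal offsets in [G], equal lattice points become equal atoms for [field]. *)
  repeat match goal with |- context [f ?a ?b k] =>
    match eval pattern y1 in a with ?A _ => match eval pattern y2 in b with ?B _ =>
      let i := eval cbv in (A 0%Z) in let j := eval cbv in (B 0%Z) in
      rewrite (HG a b i j) by lia end end end.
  apply Cpx_eq; simpl; field.
Qed.

Lemma orbit_cv0 psi : fsupp psi -> pointwise cv0 (fun n => orbit psi n).
Proof.
  intros H x1 x2 k Hk.
  set (g := fun n x1 x2 => orbit psi n x1 x2 k).
  assert (Hg : scalar_l2 g).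
  { destruct (fsupp_l2le _ H) as [M HM]. exists M; intros n l Hl.
    apply Rle_trans with (lsum (sn2 (orbit psi n)) l); [|apply l2le_orbit; assumption].
    apply lsum_le; intros p _. apply (Cnorm2_le_vnorm2 (orbit psi n (fst p) (snd p)) k Hk). }
  set (g1 := lin Ci 1 1 g). set (g2 := lin (Copp Cone) (-1) 1 g1).
  set (g3 := lin Cone (-1) 1 g2).
  assert (H4 : forall x1 x2, cv0 (fun n => lin Cone 1 (-1) g3 n x1 x2)).
  { intros y1 y2.
    pose proof (cv0_mul (mkC 4 4) _ (critical_orbit_cv0 psi H y1 (y2 + 1)%Z k Hk)) as Hc.
    eapply cv0_ext; [|exact Hc]. intro n.
    apply (critical_factor (fun n => orbit psi n)). }
  assert (c1 : Cnorm2 Cone = 1) by (unfold Cnorm2; simpl; ring).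
  assert (c2 : Cnorm2 (Copp Cone) = 1) by (unfold Cnorm2; simpl; ring).
  assert (c3 : Cnorm2 Ci = 1) by (unfold Cnorm2; simpl; ring).
  revert x1 x2; change (forall x1 x2, cv0 (fun n => g n x1 x2)).
  (* Each cancellation reduces decay of a sequence to decay of its image under one more binomial,
     until [H4] applies. *)
  apply (lin_cancel Ci 1 1); [exact c3|lia|assumption|fold g1].
  apply (lin_cancel (Copp Cone) (-1) 1); [exact c2|lia|unfold g1; repeat apply scalar_l2_lin; assumption|fold g2].
  apply (lin_cancel Cone (-1) 1); [exact c1|lia|unfold g2, g1; repeat apply scalar_l2_lin; assumption|fold g3].
  apply (lin_cancel Cone 1 (-1)); [exact c1|lia|unfold g3, g2, g1; repeat apply scalar_l2_lin; assumption|].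
  assumption.
Qed.

Lemma orbit_vnorm2_cv psi x1 x2 : fsupp psi ->
  Un_cv (fun n => vnorm2 (orbit psi n x1 x2)) 0.
Proof.
  intros H eps He.
  assert (HN : forall k, (k < 4)%nat -> exists N, forall n, (N <= n)%nat ->
     Cnorm2 (orbit psi n x1 x2 k) < eps / 4)
    by (intros k Hk; apply (orbit_cv0 psi H x1 x2 k Hk); lra).
  destruct (HN 0%nat) as [N0 H0]; [lia|]. destruct (HN 1%nat) as [N1 H1]; [lia|].
  destruct (HN 2%nat) as [N2 H2]; [lia|]. destruct (HN 3%nat) as [N3 H3]; [lia|].
  exists (N0 + N1 + N2 + N3)%nat; intros n Hn.
  specialize (H0 n ltac:(lia)); specialize (H1 n ltac:(lia));
  specialize (H2 n ltac:(lia)); specialize (H3 n ltac:(lia)).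
  unfold Rdist. rewrite Rminus_0_r, Rabs_pos_eq by apply vnorm2_ge0.
  unfold vnorm2, rsum4. lra.
Qed.

Lemma fsupp_delta0 phi : fsupp (delta0 phi).
Proof.
  exists 0%Z; intros x1 x2 k H. unfold delta0.
  destruct (Z.eqb_spec x1 0), (Z.eqb_spec x2 0); simpl; try reflexivity. lia.
Qed.

(** * Approximation of l2 states by finitely supported ones *)

Lemma lsum_list_prod {A B} (g : A * B -> R) l l' :
  lsum g (list_prod l l') = lsum (fun a => lsum (fun b => g (a, b)) l') l.
Proof.
  induction l as [|a l IH]; simpl; [reflexivity|].
  rewrite lsum_app, lsum_map, IH. reflexivity.
Qed.

Lemma sum_f_R0_lsum F n : sum_f_R0 F n = lsum F (seq 0 (S n)).
Proof.
  induction n as [|n IH]; [simpl; ring|].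
  rewrite seq_S, lsum_app, <- IH. simpl. ring.
Qed.

Lemma box_sum_lsum N g : box_sum N g = lsum (fun p => g (fst p) (snd p)) (box N).
Proof.
  unfold box_sum, box, zrange. rewrite lsum_list_prod, lsum_map, sum_f_R0_lsum.
  f_equal. apply functional_extensionality; intro i.
  rewrite lsum_map, sum_f_R0_lsum. reflexivity.
Qed.

Lemma list_bounded (l : list pt) :
  exists N : nat, forall p, In p l -> (Z.abs (fst p) + Z.abs (snd p) <= Z.of_nat N)%Z.
Proof.
  induction l as [|p l [N HN]]; [exists 0%nat; intros ? []|].
  exists (Z.to_nat (Z.abs (fst p) + Z.abs (snd p)) + N)%nat.
  intros q [->|Hq]; [lia|]. specialize (HN q Hq); lia.
Qed.

Lemma in_l2_l2le f : in_l2 f -> exists M, l2le f M.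
Proof.
  intros [M HM]; exists M; intros l Hl. destruct (list_bounded l) as [N HN].
  eapply Rle_trans; [|apply (HM N)]. rewrite box_sum_lsum.
  apply lsum_incl; [apply sn2_ge0 | assumption|].
  intros [x1 x2] Hx. specialize (HN _ Hx); simpl in HN. apply In_box; lia.
Qed.

Definition restrict (b : pt -> bool) (f : state) : state :=
  fun x1 x2 k => if b (x1, x2) then f x1 x2 k else C0.

Lemma sn2_restrict b f p : sn2 (restrict b f) p = if b p then sn2 f p else 0.
Proof.
  destruct p as [x1 x2]. unfold sn2, restrict, vnorm2, rsum4; cbn [fst snd].
  destruct (b (x1, x2)); [reflexivity|]. unfold Cnorm2; simpl; ring.
Qed.

Lemma lsum_restrict b f l : lsum (sn2 (restrict b f)) l = lsum (sn2 f) (filter b l).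
Proof.
  induction l as [|p l IH]; simpl; [reflexivity|].
  rewrite sn2_restrict, IH. destruct (b p); simpl; ring.
Qed.

Definition inb (l : list pt) (p : pt) : bool := if in_dec pt_dec p l then true else false.

Lemma fsupp_restrict l f : fsupp (restrict (inb l) f).
Proof.
  destruct (list_bounded l) as [N HN]. exists (Z.of_nat N); intros x1 x2 k H.
  unfold restrict, inb. destruct (in_dec pt_dec (x1, x2) l) as [Hi|]; [|reflexivity].
  specialize (HN _ Hi); simpl in HN; lia.
Qed.

Lemma restrict_split b f : f = sadd (restrict b f) (restrict (fun p => negb (b p)) f).
Proof.
  apply state_ext; intros. unfold sadd, restrict. destruct (b (x1, x2)); simpl; ring.
Qed.

(** S is the squared l2 norm, obtained as the supremum of the finite sums. *)
Lemma l2_lub f : in_l2 f -> exists S, l2le f S /\ forall M, l2le f M -> S <= M.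
Proof.
  intro H. destruct (in_l2_l2le f H) as [M HM].
  destruct (completeness (fun s => exists l, NoDup l /\ s = lsum (sn2 f) l)) as [S [HS1 HS2]].
  - exists M. intros s [l [Hl ->]]. auto.
  - exists 0, []. split; [constructor|reflexivity].
  - exists S; split.
    + intros l Hl. apply HS1. exists l; auto.
    + intros M' HM'. apply HS2. intros s [l [Hl ->]]. auto.
Qed.

(** Some finite set l carries more than S - eps of the squared norm S, as otherwise S - eps would be
    a smaller upper bound. Any finite set disjoint from l then carries at most eps. *)
Lemma l2_tail f eps : in_l2 f -> 0 < eps ->
  exists l, l2le (restrict (fun p => negb (inb l p)) f) eps.
Proof.
  intros H He. destruct (l2_lub f H) as [S [HS1 HS2]].
  destruct (Classical_Prop.classic (exists l, NoDup l /\ S - eps < lsum (sn2 f) l))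
    as [[l [Hl HlS]]|Hn].
  - exists l. intros l' Hl'. rewrite lsum_restrict.
    assert (Hd : NoDup (l ++ filter (fun p => negb (inb l p)) l')).
    { apply NoDup_app; [assumption | apply NoDup_filter; assumption |].
      intros p Hp Hf. apply filter_In in Hf. destruct Hf as [_ Hf]. unfold inb in Hf.
      destruct (in_dec pt_dec p l); [discriminate | contradiction]. }
    specialize (HS1 _ Hd). rewrite lsum_app in HS1. lra.
  - exfalso. assert (S <= S - eps); [|lra]. apply HS2. intros l Hl.
    apply Rnot_lt_le. intro Hc. apply Hn. exists l; auto.
Qed.

Lemma orbit_add f g n : orbit (sadd f g) n = sadd (orbit f n) (orbit g n).
Proof. induction n as [|n IH]; simpl; [reflexivity|]. rewrite IH, U_add. reflexivity. Qed.

Lemma orbit_vnorm2_small f x1 x2 eps : in_l2 f -> 0 < eps ->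
  exists n, vnorm2 (orbit f n x1 x2) < eps.
Proof.
  (* The finite part decays and the tail stays below eps/8 along its orbit; [vnorm2_add] doubles
     both, for a total of at most eps/2. *)
  intros H He. destruct (l2_tail f (eps / 8) H) as [l Hl]; [lra|].
  destruct (orbit_vnorm2_cv (restrict (inb l) f) x1 x2 (fsupp_restrict l f) (eps / 8))
    as [n Hn]; [lra|].
  exists n. specialize (Hn n (le_n n)). unfold Rdist in Hn.
  rewrite Rminus_0_r, Rabs_pos_eq in Hn by apply vnorm2_ge0.
  rewrite (restrict_split (inb l) f), orbit_add.
  pose proof (l2le_point _ _ x1 x2 (l2le_orbit _ _ n Hl)) as Ht.
  eapply Rle_lt_trans; [apply vnorm2_add|]. lra.
Qed.

Theorem mainTheorem1 :
  (forall lam : Cpx, ~ is_eigenvalue F4 lam) /\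
  (forall (phi : vec), vnorm2 phi = 1 ->
     forall x1 x2 : Z, Un_cv (fun n => p_n F4 n phi x1 x2) 0).
Proof.
  split.
  - intros lam [f [Hf [[x1 [x2 [j [Hj Hne]]]] HU]]].
    assert (Hpos : 0 < vnorm2 (f x1 x2)).
    { apply Rnot_le_lt; intro Hc. apply Hne, Cnorm2_eq0.
      eapply Rle_trans; [apply Cnorm2_le_vnorm2, Hj | exact Hc]. }
    assert (Hlam : 1 <= Cnorm2 lam).
    { destruct (l2_lub f Hf) as [S [HS1 HS2]].
      assert (S <= Cnorm2 lam * S).
      { apply HS2, U_l2le. intros l Hl.
        replace (lsum (sn2 (U f)) l) with (Cnorm2 lam * lsum (sn2 f) l).
        - apply Rmult_le_compat_l; [apply Cnorm2_ge0 | auto].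
        - rewrite <- lsum_scal. f_equal. apply functional_extensionality; intro p.
          unfold sn2. rewrite <- vnorm2_mul. symmetry. apply vnorm2_ext.
          intros k Hk; auto. }
      pose proof (l2le_point _ _ x1 x2 HS1). nra. }
    (* The scalar c is lam^n, of which only the modulus bound is kept: the orbit at the chosen point
       never gets smaller than f there. *)
    assert (Horb : forall n, exists c, 1 <= Cnorm2 c /\ state_eq (orbit f n) (smul c f)).
    { induction n as [|n [c [Hc IH]]].
      - exists Cone; split; [unfold Cnorm2; simpl; lra|].
        intros y1 y2 k Hk; unfold smul; simpl; ring.
      - exists (Cmul c lam); split; [rewrite Cnorm2_mul; nra|].
        intros y1 y2 k Hk. simpl. rewrite (U_state_eq _ _ IH), U_mul. unfold smul.
        rewrite HU by assumption. ring. }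
    destruct (orbit_vnorm2_small f x1 x2 (vnorm2 (f x1 x2)) Hf Hpos) as [n Hn].
    destruct (Horb n) as [c [Hc E]].
    rewrite (vnorm2_ext _ (fun k => Cmul c (f x1 x2 k))), vnorm2_mul in Hn by apply E.
    nra.
  - intros phi _ x1 x2. apply orbit_vnorm2_cv, fsupp_delta0.
Qed.
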